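(* Let $m,n\ge 1$ and let $f:\mathbb{X}\to\mathbb{R}^{m\times n}$ be a query function with finite $\ell_2$-sensitivity $s_2(f)$. Let $\varepsilon>0$ and $\delta\in(0,1)$, and let $B>0$ be the root of $g(x)=\delta$, where for $x>0$ $$g(x)=\Phi\!\left(\frac{x}{2}-\frac{\varepsilon}{x}\right)-e^{\varepsilon}\,\Phi\!\left(-\frac{x}{2}-\frac{\varepsilon}{x}\right).$$ Then the mechanism which on input $X\in\mathbb{X}$ outputs $$f(X)+\frac{s_2(f)}{B}\,N,$$ where $N$ is an $m\times n$ random matrix with i.i.d. $\mathcal{N}(0,1)$ entries, is $(\varepsilon,\delta)$-differentially private.
   Context: $\Phi$ is the cumulative distribution function of the standard normal distribution. $\|\cdot\|_F$ is the Frobenius norm. $\mathbb{X}$ is a set of datasets; $X\simeq X'$ (adjacent) means that the datasets $X,X'$ differ by one record, a symmetric relation also written $d(X,X')=1$. The $\ell_2$-sensitivity of $f$ is $s_2(f)=\sup_{X\simeq X'}\|f(X)-f(X')\|_F$. A randomized mechanism $K$ is $(\varepsilon,\delta)$-differentially private if for all adjacent $X\simeq X'$ and all measurable output sets $\mathcal{O}$, $\Pr(K(X)\in\mathcal{O})\le e^{\varepsilon}\Pr(K(X')\in\mathcal{O})+\delta$. The function $g$ is strictly increasing on $(0,\infty)$ with range $(0,1)$, so the root $B$ exists and is unique. *)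

(* Defs.v *)
From HB Require Import structures.
From mathcomp Require Import all_boot all_order all_algebra.
From mathcomp Require Import all_classical all_reals all_analysis.

Set Implicit Arguments.
Unset Strict Implicit.
Unset Printing Implicit Defensive.

Import Order.TTheory GRing.Theory Num.Theory.
Import numFieldNormedType.Exports.

Local Open Scope classical_set_scope.
Local Open Scope ring_scope.

Definition Phi (R : realType) (x : R) : R :=
  fine (normal_prob (0 : R) 1 `]-oo, x]).

Definition g (R : realType) (eps x : R) : R :=
  Phi (x / 2 - eps / x) - expR eps * Phi (- (x / 2) - eps / x).

(* The library norm `|A| on matrices is the max norm, hence this definition. *)
Definition frobenius (R : realType) (m n : nat) (A : 'M[R]_(m, n)) : R :=
  Num.sqrt (\sum_(i < m) \sum_(j < n) A i j ^+ 2).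

(* If no two datasets are adjacent this is ereal_sup set0 = -oo, whose [fine]
   is 0, the supremum of the empty set in [0, +oo]. *)
Definition l2_sensitivity (R : realType) (D : Type) (adj : D -> D -> Prop)
    (m n : nat) (f : D -> 'M[R]_(m, n)) : \bar R :=
  ereal_sup [set (frobenius (f p.1 - f p.2))%:E | p in [set p | adj p.1 p.2]].

(* m x n matrices with their Borel sigma-algebra; the topology is the
   entrywise (i.e. Euclidean) one. *)
Notation borel_matrix R m n := (g_sigma_algebraType (@open 'M[R]_(m, n))).

Definition entry (T : Type) (R : realType) (m n : nat)
    (N : T -> borel_matrix R m n) (ij : 'I_m * 'I_n) : T -> R :=
  fun w => (N w : 'M[R]_(m, n)) ij.1 ij.2.

Definition mutually_independent d (T : measurableType d) (R : realType)
    (P : probability T R) (I : finType) (X : I -> T -> R) : Prop :=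
  forall (J : {set I}) (A : I -> set R), (forall i, measurable (A i)) ->
    P (\bigcap_(i in [set` J]) X i @^-1` A i) =
    (\prod_(i in J) P (X i @^-1` A i))%E.

Definition has_law d (T : measurableType d) (R : realType)
    (P : probability T R) (X : T -> R) (mu : set R -> \bar R) : Prop :=
  forall A : set R, measurable A -> P (X @^-1` A) = mu A.

Definition iid_std_normal d (T : measurableType d) (R : realType)
    (P : probability T R) (m n : nat) (N : {RV P >-> borel_matrix R m n}) :
    Prop :=
  mutually_independent P (entry N) /\
  forall ij, has_law P (entry N ij) (normal_prob (0 : R) 1).

Definition differentially_private d (T : measurableType d) (R : realType)
    (P : probability T R) d' (Y : measurableType d') (D : Type)
    (adj : D -> D -> Prop) (eps delta : R) (K : D -> {RV P >-> Y}) : Prop :=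
  forall x x' : D, adj x x' -> forall O : set Y, measurable O ->
    (P (K x @^-1` O) <= (expR eps)%:E * P (K x' @^-1` O) + delta%:E)%E.

Section additive_noise.
Context d (T : measurableType d) (R : realType) (P : probability T R).
Context (m n : nat) (N : {RV P >-> borel_matrix R m n}).

Definition additive_noise (M : 'M[R]_(m, n)) (c : R) : T -> borel_matrix R m n :=
  fun w => M + c *: (N w : 'M[R]_(m, n)).

Lemma measurable_additive_noise M c :
  measurable_fun [set: T] (additive_noise M c).
Proof.
pose h (A : borel_matrix R m n) : borel_matrix R m n :=
  M + c *: (A : 'M[R]_(m, n)).
have ch : continuous (h : 'M[R]_(m, n) -> 'M[R]_(m, n)).
  move=> A; apply: (@continuousD _ _ _ (fun=> M) (fun A => c *: A)).
    exact: cst_continuous.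
  exact: scaler_continuous.
have mh : measurable_fun [set: borel_matrix R m n] h.
  apply: (@measurability _ _ _ _ _ h (@open 'M[R]_(m, n))) => //.
  move=> _ [U oU <-]; rewrite setTI.
  by apply: sub_sigma_algebra; move/continuousP: ch; exact.
exact: (measurableT_comp mh (measurable_funPT N)).
Qed.

HB.instance Definition _ M c := isMeasurableFun.Build _ _ _ _
  (additive_noise M c) (measurable_additive_noise M c).
End additive_noise.

(* Main.v *)
(* Writing the noise law as nu and w = f(X') - f(X), scaled by the noise level
   to v with |v| <= B, one must bound nu A - e^eps nu (A - v).  The Cameron-Martin
   formula gives the translate of nu by v the density
   exp (<v, y> - |v|^2 / 2), so by Neyman-Pearson the worst A is the half space
   S = {<v, y> <= |v|^2 / 2 - eps}, on which everything is one-dimensional.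
   Instead of differentiating g, one views S as a half line ]-oo, t], for which
   Phi t - e^eps Phi (t - |v|) <= Phi t - e^eps Phi (t - B), and the
   one-dimensional Neyman-Pearson bound with shift B makes this at most g B.

   The Cameron-Martin formula is obtained for shifts of one entry from
   independence and passes to sums of shifts.  It also identifies the law of
   <u, N>, |u| = 1: the standard normal law is the only probability on the line
   satisfying the one-dimensional formula. *)

Require Import Defs.
From HB Require Import structures.
From mathcomp Require Import all_boot all_order all_algebra.
From mathcomp Require Import all_classical all_reals all_analysis.
From mathcomp Require Import measurable_realfun ring lra.

Import Order.TTheory GRing.Theory Num.Theory.
Import numFieldNormedType.Exports.

Local Open Scope classical_set_scope.
Local Open Scope ring_scope.

(** * Image measures and measures with a density *)

Section pushforward_measure.
Context d d' (T : measurableType d) (T' : measurableType d') (R : realType).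
Variables (m : {measure set T -> \bar R}) (f : T -> T').
Hypothesis mf : measurable_fun [set: T] f.

(** The measurability proof is an explicit argument, so that the image under a function not bundled
    as measurable is available as a measure. *)
Definition pushforward_measure : {measure set T' -> \bar R} :=
  ltac:(refine [the measure _ _ of pushforward m f]; exact: mf).

Lemma ge0_integral_pushforward_measure (D : set T') (F : T' -> \bar R) :
    measurable D -> measurable_fun D F -> (forall y, 0 <= F y)%E ->
  (\int[pushforward_measure]_(y in D) F y =
   \int[m]_(x in f @^-1` D) F (f x))%E.
Proof.
by move=> mD mF F0; exact: (@ge0_integral_pushforward _ _ _ _ _ _ mf m D F).
Qed.

End pushforward_measure.
Arguments pushforward_measure {d d' T T' R} m {f} mf.
Arguments ge0_integral_pushforward_measure {d d' T T' R} m {f} mf D F.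

Section measure_with_density.
Local Open Scope ereal_scope.
Context d (T : measurableType d) (R : realType).
Variables (mu : {measure set T -> \bar R}) (h : T -> R).

Definition mdensity (A : set T) : \bar R := \int[mu]_(x in A) (h x)%:E.

Hypotheses (mh : measurable_fun [set: T] h) (h0 : forall x, (0 <= h x)%R).

Let mdensity0 : mdensity set0 = 0.
Proof. by rewrite /mdensity integral_set0. Qed.

Let mdensity_ge0 A : 0 <= mdensity A.
Proof. by apply: integral_ge0 => x _; rewrite lee_fin. Qed.

Let mdensity_sigma_additive : semi_sigma_additive mdensity.
Proof.
move=> F mF tF mUF; rewrite /mdensity ge0_integral_bigcup//.
- apply: is_cvg_ereal_nneg_natsum_cond => n _ _.
  by apply: integral_ge0 => x _; rewrite lee_fin.
- exact/measurable_EFinP/measurable_funTS.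
- by move=> x _; rewrite lee_fin.
Qed.

HB.instance Definition _ := isMeasure.Build _ _ _ mdensity
  mdensity0 mdensity_ge0 mdensity_sigma_additive.

Definition mdensity_measure : {measure set T -> \bar R} := mdensity.

End measure_with_density.
Arguments mdensity_measure {d T R} mu h mh h0.

(** * Integration against a density and the Neyman-Pearson inequality *)

Section density.
Local Open Scope ereal_scope.
Context d (T : measurableType d) (R : realType).
Variables (mu nu : {measure set T -> \bar R}) (h : T -> R).
Hypotheses (mh : measurable_fun [set: T] h) (h0 : forall x, (0 <= h x)%R).
Hypothesis nuE : forall A, measurable A -> nu A = \int[mu]_(x in A) (h x)%:E.

Import HBNNSimple.

(** By linearity it is enough to treat the indicator of a level set of [s], where the formula is
    [nuE]. *)
Let integral_density_nnsfun (s : {nnsfun T >-> R}) :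
  \int[nu]_x (s x)%:E = \int[mu]_x ((s x)%:E * (h x)%:E).
Proof.
under eq_integral do rewrite fimfunE -fsumEFin//.
rewrite ge0_integral_fsum//; last 2 first.
- by move=> r; exact/measurable_EFinP/measurable_funM.
- by move=> r x _; exact: nnfun_muleindic_ge0.
under [RHS]eq_integral => x _.
  rewrite fimfunE -fsumEFin// ge0_mule_fsuml; last first.
    by move=> r; exact: nnfun_muleindic_ge0.
  over.
rewrite ge0_integral_fsum//; last 2 first.
- move=> r; apply: emeasurable_funM; last exact/measurable_EFinP.
  exact/measurable_EFinP/measurable_funM.
- by move=> r x _; apply: mule_ge0; rewrite ?lee_fin // -lee_fin EFinM nnfun_muleindic_ge0.
apply: eq_fsbigr => r; rewrite inE => -[x _ <-].
rewrite integralZl_indic_nnsfun// integral_indic// setIT nuE//.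
under [RHS]eq_integral do rewrite EFinM -muleA.
rewrite ge0_integralZl//.
- congr (_ * _); rewrite integral_mkcond; apply: eq_integral => y _.
  by rewrite epatch_indic muleC.
- apply: emeasurable_funM; exact/measurable_EFinP.
- by move=> y _; rewrite -EFinM lee_fin mulr_ge0.
- by rewrite lee_fin.
Qed.

(** Monotone convergence along simple functions increasing to [F]; since [h] is nonnegative, the
    products with [h] increase as well. *)
Lemma ge0_integral_density (F : T -> \bar R) :
  measurable_fun [set: T] F -> (forall x, 0 <= F x) ->
  \int[nu]_x F x = \int[mu]_x (F x * (h x)%:E).
Proof.
move=> mF F0; pose s := nnsfun_approx measurableT mF.
transitivity (limn (fun n => \int[nu]_x (s n x)%:E)).
  rewrite -monotone_convergence//.
  - by apply: eq_integral => x _; apply/esym/cvg_lim => //; exact: cvg_nnsfun_approx.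
  - by move=> n; exact/measurable_EFinP.
  - by move=> n x _; rewrite lee_fin.
  - by move=> x _ a b ab; rewrite lee_fin; exact/lefP/nd_nnsfun_approx.
under eq_fun do rewrite integral_density_nnsfun.
rewrite -monotone_convergence//.
- apply: eq_integral => x _; apply/cvg_lim => //; apply: cvgeZr => //.
  exact: cvg_nnsfun_approx.
- by move=> n; apply: emeasurable_funM; exact/measurable_EFinP.
- by move=> n x _; rewrite -EFinM lee_fin mulr_ge0.
- move=> x _ a b ab; rewrite lee_wpmul2r ?lee_fin//.
  exact/lefP/nd_nnsfun_approx.
Qed.

Lemma ge0_integral_in_density (D : set T) (F : T -> \bar R) : measurable D ->
  measurable_fun [set: T] F -> (forall x, 0 <= F x) ->
  \int[nu]_(x in D) F x = \int[mu]_(x in D) (F x * (h x)%:E).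
Proof.
move=> mD mF F0; rewrite integral_mkcond [RHS]integral_mkcond.
rewrite ge0_integral_density; first last.
- by move=> x; exact: erestrict_ge0.
- by apply/(measurable_restrictT _ mD); exact: measurable_funTS.
by apply: eq_integral => x _; rewrite !patchE; case: ifP => //; rewrite mul0e.
Qed.

(** The part [A] and [S] share contributes equally to both sides. On the rest of [A] the density of
    [c * nu] is at least 1, on the rest of [S] at most 1, so exchanging one for the other can only
    help [S]. Sums rather than differences keep the statement meaningful for infinite measures. *)
Lemma neyman_pearson (c : R) (A S : set T) : measurable A -> measurable S ->
    (0 <= c)%R -> (forall x, S x -> c * h x <= 1)%R ->
    (forall x, ~ S x -> 1 <= c * h x)%R ->
  mu A + c%:E * nu S <= mu S + c%:E * nu A.
Proof.
move=> mA mS c0 S1 NS1.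
have mch : measurable_fun [set: T] (EFin \o (fun x => c * h x)%R).
  by apply/measurable_EFinP/measurable_funM.
have cnuE B : measurable B -> c%:E * nu B = \int[mu]_(x in B) (c * h x)%:E.
  move=> mB; rewrite nuE//; under [RHS]eq_integral do rewrite EFinM.
  rewrite ge0_integralZl//.
  - exact/measurable_EFinP/measurable_funTS.
  - by move=> x _; rewrite lee_fin.
have split_by X Y (m : {measure set T -> \bar R}) : measurable X ->
    measurable Y -> m X = m (X `&` Y) + m (X `\` Y).
  by move=> mX mY; rewrite (measureDI m mX mY) addeC.
have le1 : mu (A `\` S) <= c%:E * nu (A `\` S).
  rewrite cnuE; last exact: measurableD.
  rewrite -[leLHS]mul1e -integral_cst; last exact: measurableD.
  apply: ge0_le_integral => //.
  - exact: measurableD.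
  - exact: measurable_funTS.
  - by move=> x [_ /NS1]; rewrite lee_fin.
have le2 : c%:E * nu (S `\` A) <= mu (S `\` A).
  rewrite cnuE; last exact: measurableD.
  rewrite -[leRHS]mul1e -integral_cst; last exact: measurableD.
  apply: ge0_le_integral => //.
  - exact: measurableD.
  - by move=> x _; rewrite lee_fin mulr_ge0.
  - exact: measurable_funTS.
  - by move=> x [/S1]; rewrite lee_fin.
rewrite (split_by A S mu)// (split_by S A nu)// (split_by S A mu)//.
rewrite (split_by A S nu)// (setIC S A) !ge0_muleDr//.
rewrite addeACA [leRHS]addeACA; apply: leeD => //.
by rewrite [leRHS]addeC; apply: leeD.
Qed.

End density.

(** * Translates of Lebesgue measure and of the normal law on the line *)

Section normal_prob_shift.
Context (R : realType).
Local Notation leb := (@lebesgue_measure R).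
Local Notation gauss := (normal_prob (0 : R) 1).

Let measurable_shift (t : R) :
  measurable_fun [set: measurableTypeR R]
    (fun x : measurableTypeR R => x + t : measurableTypeR R).
Proof. exact: measurable_funD. Qed.

(** The translated measure gives half-open intervals their length, which characterises Lebesgue
    measure. *)
Lemma lebesgue_measure_shift (t : R) (A : set R) : measurable A ->
  leb ((fun x => x + t) @^-1` A) = leb A.
Proof.
move=> mA; apply/esym.
pose m := pushforward_measure leb (measurable_shift t).
change (leb A = m A); apply: (@lebesgue_measure_unique R m) => //= _ [[a b]] _ <-.
change (leb `]a, b] = leb ((fun x => x + t) @^-1` `]a, b])).
have -> : (fun x => x + t) @^-1` `]a, b] = `]a - t, b - t]%classic.
  apply/seteqP; split => x /=; rewrite !in_itv/= => /andP[xa xb];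
    apply/andP; split; lra.
rewrite !lebesgue_measure_itv/= !lte_fin ltrD2r.
by case: ifP => // _; rewrite -!EFinB; congr EFin; ring.
Qed.

Lemma ge0_integral_lebesgue_shift (t : R) (A : set R) (F : R -> \bar R) :
    measurable A -> measurable_fun A F -> (forall x, 0 <= F x)%E ->
  (\int[leb]_(x in (fun x => x + t)%R @^-1` A) F (x + t)%R =
   \int[leb]_(x in A) F x)%E.
Proof.
move=> mA mF F0.
rewrite -(ge0_integral_pushforward_measure leb (measurable_shift t) A F)//.
by apply: eq_measure_integral => B mB _; exact: lebesgue_measure_shift.
Qed.

(** The quotient phi(x - t) / phi(x) of normal densities, that is, the density of N(t, 1) with
    respect to N(0, 1). *)
Definition gauss_tilt (t x : R) : R := expR (t * x - t ^+ 2 / 2).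

Lemma gauss_tilt_ge0 t x : 0 <= gauss_tilt t x.
Proof. exact: expR_ge0. Qed.

Lemma measurable_gauss_tilt t : measurable_fun [set: R] (gauss_tilt t).
Proof.
apply: measurableT_comp; first exact: measurable_expR.
by apply: measurable_funB => //; exact: measurable_funM.
Qed.

Let normal_pdfN (x : R) :
  normal_pdf 0 1 x = normal_peak 1 * expR (- (x ^+ 2 / 2)).
Proof.
rewrite normal_pdfE ?oner_eq0//; congr (_ * expR _).
by rewrite subr0 expr1n mulNr.
Qed.

(** After the substitution of x + t for x in the right-hand integral, completing the square gives
    phi(x + t) exp(t(x + t) - t^2/2) = phi(x). *)
Lemma normal_prob_shift (t : R) (A : set R) : measurable A ->
  gauss ((fun x => x + t) @^-1` A) =
  (\int[gauss]_(x in A) (gauss_tilt t x)%:E)%E.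
Proof.
move=> mA.
rewrite (@ge0_integral_in_density _ _ _ leb _ (normal_pdf 0 1))//; last first.
- by move=> x; rewrite lee_fin gauss_tilt_ge0.
- by apply/measurable_EFinP; exact: measurable_gauss_tilt.
- by move=> x; exact: normal_pdf_ge0.
- exact: measurable_normal_pdf.
rewrite -(@ge0_integral_lebesgue_shift t)//; first last.
- by move=> x; rewrite -EFinM lee_fin mulr_ge0 ?gauss_tilt_ge0 ?normal_pdf_ge0.
- apply: measurable_funTS; apply: emeasurable_funM; apply/measurable_EFinP.
    exact: measurable_gauss_tilt.
  exact: measurable_normal_pdf.
apply: eq_integral => x _; rewrite -EFinM; congr EFin.
rewrite !normal_pdfN /gauss_tilt mulrCA -expRD; congr (_ * expR _).
by field.
Qed.

(* Fubini for 1_I(x) phi(x + y) 1_C(x + y) / phi(x), with I = [0, 1] and y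
   distributed according to Lebesgue measure: the two orders of integration
   give gauss C and mu C, up to constants. *)
Lemma normal_prob_unique (mu : probability (measurableTypeR R) R) :
    (forall (t : R) (A : set R), measurable A ->
       mu ((fun x => x + t) @^-1` A) =
       (\int[mu]_(x in A) (gauss_tilt t x)%:E)%E) ->
  forall C : set R, measurable C -> mu C = gauss C.
Proof.
move=> mu_shift.
pose p : R := normal_peak 1.
have p_gt0 : 0 < p by rewrite normal_peak_gt0 ?oner_eq0.
pose I : set R := `[0, 1]%classic.
have mI : measurable I by exact: measurable_itv.
(* [E] is p / phi, the reciprocal of the normal density up to its constant. *)
pose E (x : R) : R := expR (x ^+ 2 / 2).
have mE : measurable_fun [set: R] E.
  apply: measurableT_comp; first exact: measurable_expR.
  by apply: measurable_funM => //; exact: measurable_funX.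
have E0 x : 0 <= E x by exact: expR_ge0.
have IE0 x : 0 <= \1_I x * E x by rewrite mulr_ge0 ?E0// indicE.
have mIE : measurable_fun [set: R] (fun x => \1_I x * E x).
  by apply: measurable_funM; [exact: measurable_indic|exact: mE].
pose a := (\int[mu]_x (\1_I x * E x)%:E)%E.
(* The constant [a] need not be computed: for the whole line [key] reads p = a, and then p
   cancels. *)
suff key C : measurable C -> (p%:E * mu C = a * gauss C)%E.
  move=> C mC; have := key _ measurableT.
  rewrite !probability_setT !mule1 => pa; move: (key C mC); rewrite -pa.
  move/(congr1 (fun z => p^-1%:E * z)%E); rewrite !muleA -!EFinM.
  by rewrite mulVf ?gt_eqF// !mul1e.
move=> mC.
pose phiC (z : R) : R := \1_C z * normal_pdf 0 1 z.
have mphiC : measurable_fun [set: R] phiC.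
  apply: measurable_funM; first exact: measurable_indic.
  exact: measurable_normal_pdf.
have phiC0 z : 0 <= phiC z by rewrite mulr_ge0 ?normal_pdf_ge0// indicE.
have intphiC : (\int[leb]_z (phiC z)%:E = gauss C)%E.
  rewrite /normal_prob [RHS]integral_mkcond; apply: eq_integral => z _.
  by rewrite epatch_indic -EFinM mulrC.
pose f (xy : measurableTypeR R * measurableTypeR R) : \bar R :=
  (\1_I xy.1 * E xy.1 * phiC (xy.1 + xy.2))%:E.
have f0 xy : (0 <= f xy)%E by rewrite lee_fin mulr_ge0 ?IE0 ?phiC0.
have mf : measurable_fun setT f.
  apply/measurable_EFinP; apply: measurable_funM.
    by apply: (measurableT_comp mIE); exact: measurable_fst.
  by apply: (measurableT_comp mphiC); exact: measurable_funD.
(* With y integrated first, translation invariance of Lebesgue measure turns the inner integral into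
   [gauss C], whatever x is. *)
have <- : (\int[mu]_x \int[leb]_y f (x, y) = a * gauss C)%E.
  transitivity (\int[mu]_x ((\1_I x * E x)%:E * gauss C))%E.
    apply: eq_integral => x _; rewrite /f/=.
    under eq_integral do rewrite EFinM.
    rewrite ge0_integralZl//.
    - congr (_ * _)%E; rewrite -intphiC.
      transitivity (\int[leb]_y (phiC (y + x))%:E)%E.
        by apply: eq_integral => y _; rewrite addrC.
      apply: (@ge0_integral_lebesgue_shift x setT (EFin \o phiC)) => //.
      by apply/measurable_EFinP; exact: mphiC.
    - apply/measurable_EFinP; apply: measurableT_comp => //.
      exact: measurable_funD.
    - by move=> y _; rewrite lee_fin.
    - by rewrite lee_fin IE0.
  rewrite ge0_integralZr//.
  - by apply/measurable_EFinP; exact: mIE.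
  - by move=> x _; rewrite lee_fin IE0.
rewrite (fubini_tonelli f)//.
(* [k] is what remains of the integrand once z = x + y replaces x as the variable of [mu], for y
   fixed. *)
pose k (zy : measurableTypeR R * measurableTypeR R) : \bar R :=
  (p * \1_C zy.1 * \1_I (zy.1 - zy.2))%:E.
have k0 zy : (0 <= k zy)%E by rewrite lee_fin !mulr_ge0 ?indicE// ltW.
have mk : measurable_fun setT k.
  apply/measurable_EFinP; apply: measurable_funM.
    apply: measurable_funM => //.
    by apply: measurableT_comp => //; exact: measurable_indic.
  apply: measurableT_comp; first exact: measurable_indic.
  exact: measurable_funB.
transitivity (\int[leb]_y \int[mu]_z k (z, y))%E; last first.
  apply: eq_integral => y _.
  pose F (z : R) : \bar R := (\1_I (z - y) * E (z - y) * phiC z)%:E.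
  have F0 z : (0 <= F z)%E by rewrite lee_fin mulr_ge0 ?IE0 ?phiC0.
  have mF : measurable_fun [set: measurableTypeR R] F.
    apply/measurable_EFinP; apply: measurable_funM; last exact: mphiC.
    by apply: (measurableT_comp mIE); exact: measurable_funB.
  (* The law of x + y for fixed y; by [mu_shift] its density with respect to [mu] is
     [gauss_tilt y]. *)
  pose nu := pushforward_measure mu (measurable_shift y).
  transitivity (\int[nu]_z F z)%E.
    rewrite [RHS](@ge0_integral_density _ _ _ mu nu (gauss_tilt y))//.
    - apply: eq_integral => z _; rewrite -EFinM; congr EFin.
      rewrite /phiC normal_pdfN -/p.
      transitivity (p * \1_C z * \1_I (z - y) *
         (E (z - y) * expR (- (z ^+ 2 / 2)) * gauss_tilt y z)); last by ring.
      (* The exponents cancel: (z - y)^2/2 - z^2/2 + yz - y^2/2 = 0. *)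
      suff -> : E (z - y) * expR (- (z ^+ 2 / 2)) * gauss_tilt y z = 1.
        by rewrite mulr1.
      by rewrite /E /gauss_tilt -!expRD -[RHS]expR0; congr expR; field.
    - exact: measurable_gauss_tilt.
    - exact: gauss_tilt_ge0.
    - exact: mu_shift.
  apply: etrans (ge0_integral_pushforward_measure mu (measurable_shift y)
    setT F measurableT mF F0) _.
  by apply: eq_integral => x _; rewrite /f/F/= addrK.
rewrite -(fubini_tonelli k)//.
transitivity (\int[mu]_z (p%:E * (\1_C z)%:E))%E.
  rewrite ge0_integralZl//; first by rewrite integral_indic// setIT.
  - by apply/measurable_EFinP; exact: measurable_indic.
  - by rewrite lee_fin ltW.
apply: eq_integral => z _; rewrite /k/=.
under [RHS]eq_integral do rewrite EFinM.
rewrite ge0_integralZl//.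
(* The condition 0 <= z - y <= 1 confines y to an interval of length 1. *)
- rewrite (_ : (\int[leb]_y _)%E = 1%E) ?mule1//.
  transitivity (\int[leb]_y (\1_(`[z - 1, z]%classic : set R) y)%:E)%E.
    apply: eq_integral => y _; rewrite !indicE; congr (nat_of_bool _)%:R%:E.
    apply/idP/idP; rewrite !inE/= /I/= !in_itv/= => /andP[? ?];
      apply/andP; split; lra.
  rewrite integral_indic// setIT.
  apply: (etrans (lebesgue_measure_itv `[z - 1, z])); rewrite /= lte_fin.
  by rewrite gtrBl ltr01 -EFinB opprB addrCA subrr addr0.
- apply/measurable_EFinP; apply: measurableT_comp.
    exact: measurable_indic.
  exact: measurable_funB.
- by rewrite lee_fin mulr_ge0 ?indicE// ltW.
Qed.
End normal_prob_shift.
Arguments gauss_tilt {R} t x.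
Arguments gauss_tilt_ge0 {R} t x.
Arguments measurable_gauss_tilt {R} t.
Arguments normal_prob_shift {R} t A.

(** * Boxes as generators of the Borel sigma-algebra on matrices *)

Section matrix_box.
Context (R : realType) (m n : nat).
Local Notation Y := (borel_matrix R m n).

Lemma measurable_coord (ij : 'I_m * 'I_n) :
  measurable_fun [set: Y] (fun y : Y => (y : 'M[R]_(m, n)) ij.1 ij.2).
Proof.
apply: (measurability _ (RGenOInfty.measurableE R)) => //.
move=> /= _ [_ [x ->] <-]; rewrite setTI; apply: sub_sigma_algebra.
have /continuousP := @coord_continuous R m n ij.1 ij.2; apply.
by rewrite set_itvoy; exact: open_gt.
Qed.

Definition matrix_box (A : 'I_m * 'I_n -> set R) : set Y :=
  [set y | forall ij, A ij ((y : 'M[R]_(m, n)) ij.1 ij.2)].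

Definition matrix_boxes : set (set Y) :=
  [set matrix_box A | A in [set A | forall ij, measurable (A ij)]].

Lemma measurable_matrix_box A :
  (forall ij, measurable (A ij)) -> measurable (matrix_box A).
Proof.
move=> mA.
have -> : matrix_box A = \bigcap_(ij in [set: 'I_m * 'I_n])
    ((fun y : Y => (y : 'M[R]_(m, n)) ij.1 ij.2) @^-1` A ij).
  by apply/seteqP; split => [y yA ij _|y yA ij]; [exact: yA|exact: (yA ij)].
apply: fin_bigcap_measurable => [|ij _]; first exact: finite_finset.
by rewrite -[X in measurable X]setTI; exact: measurable_coord.
Qed.

Lemma setI_closed_matrix_boxes : setI_closed matrix_boxes.
Proof.
move=> _ _ [A mA <-] [A' mA' <-]; exists (fun ij => A ij `&` A' ij).
  by move=> ij; exact: measurableI.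
apply/seteqP; split => [y yA|y [yA yA'] ij]; last by split.
by split=> ij; have [] := yA ij.
Qed.

Lemma matrix_boxesT : matrix_boxes setT.
Proof. by exists (fun=> setT) => //; apply/seteqP; split. Qed.

(** Cubes with rational centre and radius 1/(k+1): a family indexed by a countable type. *)
Let rat_box (qk : 'M[rat]_(m, n) * nat) : set Y :=
  matrix_box (fun ij => ball (ratr (qk.1 ij.1 ij.2) : R) qk.2.+1%:R^-1).

Lemma open_matrix_rat_box (U : set 'M[R]_(m, n)) : open U ->
  U = \bigcup_(qk in [set qk | rat_box qk `<=` U]) rat_box qk.
Proof.
move=> oU; apply/seteqP; split=> [x Ux|x [qk /= qkU qkx]]; last exact: qkU.
have /nbhs_ballP[e /= e0 eU] : nbhs x U by exact: open_nbhs_nbhs.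
(* Half of [e], because a point of the cube is within [r] of its centre, which is itself within [r]
   of [x]. *)
have [k ke] : exists k : nat, k.+1%:R^-1 < e / 2.
  have e20 : 0 < e / 2 by rewrite divr_gt0.
  exists (Num.truncn (e / 2)^-1); rewrite -[ltRHS]invrK ltf_pV2 ?posrE ?invr_gt0//.
  by rewrite truncnS_gt.
pose r : R := k.+1%:R^-1.
have r0 : 0 < r by rewrite invr_gt0.
have /choice[q qx] : forall ij : 'I_m * 'I_n, exists q : rat,
    `|ratr q - x ij.1 ij.2| < r.
  move=> ij; have /rat_in_itvoo[q] : x ij.1 ij.2 - r < x ij.1 ij.2 + r by lra.
  by rewrite in_itv/= -ltr_distl; exists q.
pose Q := \matrix_(i, j) q (i, j).
exists (Q, k) => [y /= yQ|ij]; last first.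
  by rewrite /ball/= mxE -surjective_pairing; exact: qx.
apply: eU; split=> // i j.
have := yQ (i, j); rewrite /ball/= mxE => yq.
have := qx (i, j); rewrite -/r in yq *; move=> /= qxij.
rewrite (splitr e); apply: (lt_trans _ (ltrD ke ke)); rewrite -/r.
rewrite -(subrKA (ratr (q (i, j)))); apply: le_lt_trans (ler_normD _ _) _.
by apply: ltrD => //; rewrite distrC.
Qed.

(** An open set is a union of rational cubes, hence a countable union of boxes; conversely boxes are
    Borel. Measures on matrices can therefore be compared on boxes alone. *)
Lemma borel_matrix_boxes : @measurable _ Y = <<s matrix_boxes >>.
Proof.
apply/seteqP; split; apply: smallest_sub; try exact: smallest_sigma_algebra.
- move=> U /= oU; rewrite (open_matrix_rat_box U oU) bigcup_mkcond.
  pose Z := g_sigma_algebraType matrix_boxes.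
  apply: (@countable_bigcupT_measurable _ Z) => // qk; case: ifP => _.
    apply: sub_sigma_algebra; eexists; last reflexivity.
    by move=> ij /=; exact: measurable_ball.
  exact: (@measurable0 _ Z).
- by move=> _ [A mA <-]; exact: measurable_matrix_box.
Qed.

End matrix_box.
Arguments measurable_coord {R m n} ij.
Arguments matrix_box {R m n} A.

(** * The Cameron-Martin formula for a standard normal matrix *)

Section standard_normal_matrix.
Context (R : realType) (m n : nat).
Local Notation Y := (borel_matrix R m n).
Local Notation gauss := (normal_prob (0 : R) 1).

(** The inner product whose norm is the Frobenius norm. *)
Definition mxdot (u y : 'M[R]_(m, n)) : R := \sum_i \sum_j u i j * y i j.

Lemma mxdotDl u v y : mxdot (u + v) y = mxdot u y + mxdot v y.
Proof.
rewrite /mxdot -big_split; apply: eq_bigr => i _; rewrite -big_split.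
by apply: eq_bigr => j _; rewrite mxE mulrDl.
Qed.

Lemma mxdotC u v : mxdot u v = mxdot v u.
Proof. by apply: eq_bigr => i _; apply: eq_bigr => j _; rewrite mulrC. Qed.

Lemma mxdotDr u v y : mxdot u (v + y) = mxdot u v + mxdot u y.
Proof. by rewrite mxdotC mxdotDl ![mxdot _ u]mxdotC. Qed.

Lemma mxdotZl t u y : mxdot (t *: u) y = t * mxdot u y.
Proof.
rewrite /mxdot mulr_sumr; apply: eq_bigr => i _; rewrite mulr_sumr.
by apply: eq_bigr => j _; rewrite mxE mulrA.
Qed.

Lemma mxdotZr t u y : mxdot u (t *: y) = t * mxdot u y.
Proof. by rewrite mxdotC mxdotZl mxdotC. Qed.

Lemma mxdotNr u y : mxdot u (- y) = - mxdot u y.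
Proof. by rewrite -scaleN1r mxdotZr mulN1r. Qed.

Lemma mxdot0l y : mxdot 0 y = 0.
Proof. by rewrite -(scale0r 0) mxdotZl mul0r. Qed.

Lemma mxdot_delta i j y : mxdot (delta_mx i j) y = y i j.
Proof.
rewrite /mxdot (bigD1 i)//= (bigD1 j)//= mxE !eqxx mul1r.
rewrite big1 ?addr0 => [|l lj]; last by rewrite mxE (negPf lj) andbF mul0r.
rewrite big1 ?addr0// => k ki.
by rewrite big1// => l _; rewrite mxE (negPf ki) mul0r.
Qed.

Lemma measurable_mxdot u : measurable_fun [set: Y] (fun y : Y => mxdot u y).
Proof.
apply: measurable_sum => i; apply: measurable_sum => j.
apply: measurable_funM; first exact: measurable_cst.
exact: (measurable_coord (i, j)).
Qed.

Lemma continuous_measurable_fun_mx (h : 'M[R]_(m, n) -> 'M[R]_(m, n)) :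
  continuous h -> measurable_fun [set: Y] (h : Y -> Y).
Proof.
move=> ch; apply: (@measurability _ _ _ _ _ (h : Y -> Y) (@open 'M[R]_(m, n))) => //.
move=> _ [U oU <-]; rewrite setTI; apply: sub_sigma_algebra.
by move/continuousP: ch; exact.
Qed.

Definition shift_mx (v : 'M[R]_(m, n)) (y : Y) : Y := (y : 'M[R]_(m, n)) + v.

Lemma measurable_shift_mx v : measurable_fun [set: Y] (shift_mx v).
Proof.
apply: (continuous_measurable_fun_mx (fun y => y + v)) => y.
apply: (@continuousD _ _ _ id (fun=> v)); first exact: cvg_id.
exact: cst_continuous.
Qed.

(** The matrix analogue of [gauss_tilt]: the density, with respect to the standard normal law, of
    its translate by [v]. *)
Definition tilt_mx (v y : 'M[R]_(m, n)) : R := expR (mxdot v y - mxdot v v / 2).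

Lemma tilt_mx_ge0 v y : 0 <= tilt_mx v y.
Proof. exact: expR_ge0. Qed.

Lemma measurable_tilt_mx v : measurable_fun [set: Y] (fun y : Y => tilt_mx v y).
Proof.
apply: (measurableT_comp (@measurable_expR R)).
by apply: measurable_funB; [exact: measurable_mxdot|exact: measurable_cst].
Qed.

Section cameron_martin.
Variable nu : probability Y R.

Definition cameron_martin (v : 'M[R]_(m, n)) : Prop :=
  forall A : set Y, measurable A ->
    nu (shift_mx v @^-1` A) = (\int[nu]_(y in A) (tilt_mx v y)%:E)%E.

Lemma cameron_martin0 : cameron_martin 0.
Proof.
move=> A mA; rewrite (_ : shift_mx 0 = id); last first.
  by apply/funext => y; rewrite /shift_mx addr0.
under eq_integral do rewrite /tilt_mx !mxdot0l mul0r subr0 expR0.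
by rewrite integral_cst// mul1e.
Qed.

(** Shifting by [v] and then by [w] yields the density [tilt_mx v (z - w) * tilt_mx w z]; the term
    -<v, w> arising from z - w is the cross term of -|v + w|^2 / 2. *)
Lemma cameron_martinD v w :
  cameron_martin v -> cameron_martin w -> cameron_martin (v + w).
Proof.
move=> cmv cmw A mA.
have mA' : measurable (shift_mx w @^-1` A).
  by rewrite -[X in measurable X]setTI; exact: measurable_shift_mx.
rewrite (_ : _ @^-1` A = shift_mx v @^-1` (shift_mx w @^-1` A)); last first.
  by apply/seteqP; split => y; rewrite /= /shift_mx addrA.
rewrite (cmv _ mA').
pose F (z : Y) : \bar R := (tilt_mx v (z - w))%:E.
have F0 z : (0 <= F z)%E by rewrite lee_fin tilt_mx_ge0.
have mF : measurable_fun [set: Y] F.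
  apply/measurable_EFinP.
  exact: (measurableT_comp (measurable_tilt_mx v) (measurable_shift_mx (- w))).
transitivity (\int[pushforward_measure nu (measurable_shift_mx w)]_(z in A) F z)%E.
  apply: esym; apply: etrans (ge0_integral_pushforward_measure nu
    (measurable_shift_mx w) A F mA _ F0) _; first exact: measurable_funTS.
  by apply: eq_integral => y _; rewrite /F/= /shift_mx addrK.
rewrite (@ge0_integral_in_density _ _ _ nu _ (fun y : Y => tilt_mx w y))//.
- apply: eq_integral => z _; rewrite -EFinM; congr EFin.
  rewrite /tilt_mx -expRD; congr expR.
  by rewrite !mxdotDr !mxdotDl mxdotNr (mxdotC w v); field.
- exact: measurable_tilt_mx.
- by move=> y; exact: tilt_mx_ge0.
Qed.

Hypothesis nu_box : forall A : 'I_m * 'I_n -> set R,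
  (forall ij, measurable (A ij)) ->
  nu (matrix_box A) = (\prod_ij gauss (A ij))%E.

(* Both sides are finite measures in A, and agree on boxes. *)
Lemma cameron_martin_delta t i j : cameron_martin (t *: delta_mx i j).
Proof.
set v := t *: delta_mx i j; pose k := (i, j).
have tiltE y : tilt_mx v y = gauss_tilt t (y i j).
  rewrite /tilt_mx /gauss_tilt !mxdotZl mxdotZr !mxdot_delta mxE !eqxx/=.
  by rewrite mulr1 expr2.
have shiftE (y : Y) l : (shift_mx v y : 'M[R]_(m, n)) l.1 l.2 =
    (y : 'M[R]_(m, n)) l.1 l.2 + (if l == k then t else 0).
  case: l => a b; rewrite !mxE/= -pair_eqE/=.
  by case: ifP => _; rewrite ?mulr1 ?mulr0.
have mt := measurable_tilt_mx v.
have mshift : measurable_fun [set: R] (fun x : R => x + t).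
  exact: measurable_funD.
move=> A mA.
apply: (@measure_unique _ R Y (matrix_boxes R m n) (fun=> setT)
  (borel_matrix_boxes R m n) (setI_closed_matrix_boxes R m n)
  (fun=> matrix_boxesT R m n) _
  (pushforward_measure nu (measurable_shift_mx v))
  (mdensity_measure nu (fun y : Y => tilt_mx v y) mt (tilt_mx_ge0 v))) => //.
- by rewrite bigcup_const.
- move=> _ [B /= mB <-].
  change (nu (shift_mx v @^-1` matrix_box B) =
    \int[nu]_(y in matrix_box B) (tilt_mx v y)%:E)%E.
  (* Only entry [k] is shifted, so the sides of the box other than [k] contribute the constant
     factor [c] throughout. *)
  pose c : R := \prod_(l | l != k) fine (gauss (B l)).
  have cE : (\prod_(l | l != k) gauss (B l) = c%:E)%E.
    by rewrite -prodEFin; apply: eq_bigr => l _; rewrite fineK// fin_num_measure//; exact: mB.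
  have c0 : 0 <= c.
    by apply: prodr_ge0 => l _; rewrite fine_ge0.
  pose B' C l := if l == k then C else B l.
  have mB' C : measurable C -> forall l, measurable (B' C l).
    by move=> mC l; rewrite /B'; case: ifP.
  have nuB' C : measurable C ->
      nu (matrix_box (B' C)) = (c%:E * gauss C)%E.
    move=> mC; rewrite nu_box; last exact: mB'.
    rewrite (bigD1 k)//= {1}/B' eqxx -cE muleC; congr (_ * _)%E.
    by apply: eq_bigr => l /negPf lk; rewrite /B' lk.
  pose E := matrix_box (B' setT).
  have mE : measurable E by apply: measurable_matrix_box; exact: mB'.
  have m1E : measurable_fun [set: Y] (\1_E : Y -> R) by exact: measurable_indic.
  have ge01E y : 0 <= (\1_E y : R) by rewrite indicE.
  (* [nuE] is [nu] restricted to [E], the box [B] freed of its constraint on entry [k]. The image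
     [Q] of [nuE] under that entry is then [c] times the standard normal law. *)
  pose nuE := mdensity_measure nu (\1_E : Y -> R) m1E ge01E.
  have mk : measurable_fun [set: Y]
      (fun y : Y => (y : 'M[R]_(m, n)) k.1 k.2 : measurableTypeR R).
    exact: measurable_coord.
  pose Q := pushforward_measure nuE mk.
  pose g (x : R) : \bar R := (gauss_tilt t x)%:E.
  have mg : measurable_fun [set: R] g.
    by apply/measurable_EFinP; exact: measurable_gauss_tilt.
  have g0 x : (0 <= g x)%E by rewrite lee_fin gauss_tilt_ge0.
  have boxE C : matrix_box (B' C) =
      ((fun y : Y => (y : 'M[R]_(m, n)) k.1 k.2) @^-1` C) `&` E.
    apply/seteqP; split => [y yB|y [yC yE] l].
      split; first by have := yB k; rewrite /B' eqxx.
      by move=> l; have := yB l; rewrite /B'; case: eqP.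
    by have := yE l; rewrite /B'; case: eqP => // ->.
  have BE : matrix_box B = matrix_box (B' (B k)).
    by congr (matrix_box _); apply/funext => l; rewrite /B'; case: eqP => // ->.
  have mkC C : measurable C ->
      measurable ((fun y : Y => (y : 'M[R]_(m, n)) k.1 k.2) @^-1` C).
    by move=> mC; rewrite -[X in measurable X]setTI; exact: measurable_coord.
  (* The left side reaches this integral by the one-dimensional shift formula, the right side by a
     change of variables. *)
  transitivity (\int[Q]_(x in B k) g x)%E.
    transitivity (\int[mscale (NngNum c0) gauss]_(x in B k) g x)%E.
      rewrite ge0_integral_mscale//=; last exact: measurable_funTS.
      rewrite -normal_prob_shift// -nuB'; last first.
        by rewrite -[X in measurable X]setTI; exact: mshift.
      congr (nu _); apply/seteqP; split => y yB l; have := yB l;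
        rewrite /B' shiftE; case: eqP => [->|_] //=; by rewrite addr0.
      exact: mB.
    apply: eq_measure_integral => C mC _.
    transitivity (nu (matrix_box (B' C))); first by rewrite nuB'.
    rewrite boxE; change (nu (((fun y : Y => (y : 'M[R]_(m, n)) k.1 k.2) @^-1` C)
       `&` E) = \int[nu]_(y in (fun y : Y => (y : 'M[R]_(m, n)) k.1 k.2) @^-1` C)
         (\1_E y)%:E)%E.
    by rewrite integral_indic; [rewrite setIC|exact: mkC|exact: mE].
  apply: etrans (ge0_integral_pushforward_measure nuE mk (B k) g (mB k) _ g0) _.
    exact: measurable_funTS.
  rewrite (@ge0_integral_in_density _ _ _ nu nuE \1_E)//.
  - rewrite BE boxE integral_mkcondr; apply: eq_integral => y _.
    by rewrite epatch_indic tiltE.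
  - exact: mkC.
  - exact: (measurableT_comp mg mk).
- move=> _; change (nu (shift_mx v @^-1` setT) < +oo)%E.
  by rewrite preimage_setT probability_setT ltry.
Qed.

Lemma cameron_martin_std_normal v : cameron_martin v.
Proof.
rewrite (matrix_sum_delta v).
apply: (big_ind _ cameron_martin0 cameron_martinD) => i _.
apply: (big_ind _ cameron_martin0 cameron_martinD) => j _.
exact: cameron_martin_delta.
Qed.

(* The law of <u, .> inherits the Cameron-Martin formula from nu. *)
Lemma std_normal_mxdot u (A : set R) : mxdot u u = 1 -> measurable A ->
  nu ((fun y : Y => mxdot u y) @^-1` A) = gauss A.
Proof.
move=> u1 mA.
have mu' : measurable_fun [set: Y] (fun y : Y => mxdot u y : measurableTypeR R).
  exact: measurable_mxdot.
pose X : {mfun Y >-> measurableTypeR R} := HB.pack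
  (fun y : Y => mxdot u y : measurableTypeR R) (isMeasurableFun.Build _ _ _ _ _ mu').
apply: (@normal_prob_unique R (distribution nu X)) => // t C mC.
have mXC : measurable (X @^-1` C).
  by rewrite -[X in measurable X]setTI; exact: measurable_mxdot.
(* As |u| = 1, translating <u, y> by [t] amounts to translating y by [t *: u]. *)
transitivity (nu (shift_mx (t *: u) @^-1` (X @^-1` C))).
  rewrite /distribution /pushforward; congr (nu _).
  by apply/seteqP; split => y /=; rewrite /shift_mx mxdotDr mxdotZr u1 mulr1.
rewrite cameron_martin_std_normal//.
apply: esym; apply: etrans (ge0_integral_pushforward_measure nu mu' C
  (EFin \o gauss_tilt t) mC _ _) _.
- by apply/measurable_EFinP/measurable_funTS; exact: measurable_gauss_tilt.
- by move=> x; rewrite lee_fin gauss_tilt_ge0.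
apply: eq_integral => y _ /=; congr (expR _)%:E.
by rewrite !mxdotZl mxdotZr u1 mulr1.
Qed.

End cameron_martin.
End standard_normal_matrix.
Arguments mxdot {R m n} u y.
Arguments shift_mx {R m n} v y.
Arguments measurable_shift_mx {R m n} v.
Arguments tilt_mx {R m n} v y.
Arguments tilt_mx_ge0 {R m n} v y.
Arguments measurable_tilt_mx {R m n} v.
Arguments cameron_martin_std_normal {R m n nu} nu_box v A _.
Arguments std_normal_mxdot {R m n nu} nu_box u A.

(** * The one-dimensional bound by g *)

Section analytic_gaussian_bound.
Context (R : realType).
Local Notation gauss := (normal_prob (0 : R) 1).

Lemma normal_prob_itvNyc (x : R) : gauss `]-oo, x] = (Phi x)%:E.
Proof. by rewrite /Phi fineK// fin_num_measure//; exact: measurable_itv. Qed.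

Lemma le_Phi (x y : R) : x <= y -> Phi x <= Phi y.
Proof.
move=> xy; rewrite -lee_fin -!normal_prob_itvNyc; apply: le_measure.
- by rewrite inE; exact: measurable_itv.
- by rewrite inE; exact: measurable_itv.
- by move=> z /=; rewrite !in_itv/= => /le_trans; apply.
Qed.

(** Neyman-Pearson for N(0, 1) against N(b, 1), with an arbitrary half line as competitor; the
    optimal half line ends at b/2 - eps/b and yields exactly [g eps b]. *)
Lemma Phi_le_g (eps b t : R) : 0 < b ->
  Phi t <= g eps b + expR eps * Phi (t - b).
Proof.
move=> b0.
pose nu := mdensity_measure gauss _ (measurable_gauss_tilt b) (gauss_tilt_ge0 b).
have nu_itv x : nu `]-oo, x]%classic = (Phi (x - b))%:E.
  rewrite -normal_prob_itvNyc -[LHS]normal_prob_shift; last exact: measurable_itv.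
  by congr (normal_prob _ _ _); apply/seteqP; split => z /=; rewrite !in_itv/= lerBrDr.
(* The endpoint is the zero of the exponent eps + bx - b^2/2. *)
have tiltE x : (expR eps * gauss_tilt b x <= 1) = (x <= b / 2 - eps / b).
  rewrite /gauss_tilt -expRD expR_le1 -[RHS](ler_pM2l b0) -[LHS]subr_ge0 -[RHS]subr_ge0.
  by congr (0 <= _); field; rewrite gt_eqF.
have tilt_ge x : ~ x <= b / 2 - eps / b -> 1 <= expR eps * gauss_tilt b x.
  by rewrite -tiltE => /negP; rewrite -ltNge => /ltW.
have : (gauss `]-oo, t] + (expR eps)%:E * nu `]-oo, (b / 2 - eps / b)%R]%classic <=
    gauss `]-oo, (b / 2 - eps / b)%R] + (expR eps)%:E * nu `]-oo, t]%classic)%E.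
  apply: (@neyman_pearson _ _ _ gauss nu _ (measurable_gauss_tilt b)
    (gauss_tilt_ge0 b) (fun _ _ => erefl)).
  - exact: measurable_itv.
  - exact: measurable_itv.
  - exact: expR_ge0.
  - by move=> x /=; rewrite in_itv/= tiltE.
  - by move=> x /=; rewrite in_itv/=; exact: tilt_ge.
rewrite !normal_prob_itvNyc !nu_itv -!EFinM -!EFinD lee_fin.
rewrite /g (_ : b / 2 - eps / b - b = - (b / 2) - eps / b); first lra.
by field; rewrite gt_eqF.
Qed.

End analytic_gaussian_bound.
Arguments Phi_le_g {R} eps {b} t.

(** * The bound for shifts of a standard normal matrix *)

Section gaussian_mechanism_matrix.
Context (R : realType) (m n : nat).
Local Notation Y := (borel_matrix R m n).
Local Notation gauss := (normal_prob (0 : R) 1).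
Variable nu : probability Y R.
Hypothesis nu_box : forall A : 'I_m * 'I_n -> set R,
  (forall ij, measurable (A ij)) ->
  nu (matrix_box A) = (\prod_ij gauss (A ij))%E.

Lemma std_normal_shift_le (eps b : R) (v : 'M[R]_(m, n)) (A : set Y) :
    measurable A -> 0 < b -> 0 < mxdot v v <= b ^+ 2 ->
  (nu A <= (expR eps)%:E * nu (shift_mx v @^-1` A) + (g eps b)%:E)%E.
Proof.
move=> mA b0 /andP[v0 vb].
pose r := Num.sqrt (mxdot v v).
have r0 : 0 < r by rewrite sqrtr_gt0.
have rE : mxdot v v = r ^+ 2 by rewrite sqr_sqrtr// ltW.
have rb : r <= b by rewrite -ler_sqr ?nnegrE ?(ltW r0) ?(ltW b0)// -rE.
pose u := r^-1 *: v.
have vE : v = r *: u by rewrite scalerA divff ?scale1r// gt_eqF.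
have u1 : mxdot u u = 1.
  by rewrite mxdotZl mxdotZr rE; field; rewrite gt_eqF.
(* Along the unit vector [u], the exponent eps + r<u, y> - r^2/2 vanishes where <u, y> = t. *)
pose t := r / 2 - eps / r.
pose S : set Y := (fun y : Y => mxdot u y) @^-1` `]-oo, t].
have mS : measurable S.
  rewrite -[X in measurable X]setTI.
  by apply: (measurable_mxdot R m n u).
have nuS : nu S = (Phi t)%:E.
  by rewrite -normal_prob_itvNyc; apply: (std_normal_mxdot nu_box).
have nuvS : nu (shift_mx v @^-1` S) = (Phi (t - r))%:E.
  rewrite -normal_prob_itvNyc -(std_normal_mxdot nu_box u)//.
  congr (nu _); apply/seteqP; split => y /=;
    rewrite /S /shift_mx/= !in_itv/= mxdotDr [in mxdot u v]vE mxdotZr u1; lra.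
have tiltE y : (expR eps * tilt_mx v y <= 1) = (mxdot u y <= t).
  rewrite /tilt_mx -expRD expR_le1 rE [in mxdot v y]vE mxdotZl.
  rewrite -[RHS](ler_pM2l r0) -[LHS]subr_ge0 -[RHS]subr_ge0 /t.
  by congr (0 <= _); field; rewrite gt_eqF.
have cmv := cameron_martin_std_normal nu_box v.
pose nuv := pushforward_measure nu (measurable_shift_mx v).
have mvA : measurable (shift_mx v @^-1` A).
  by rewrite -[X in measurable X]setTI; exact: measurable_shift_mx.
have : (nu A + (expR eps)%:E * nuv S <= nu S + (expR eps)%:E * nuv A)%E.
  apply: (@neyman_pearson _ _ _ nu nuv _ (measurable_tilt_mx v)
    (tilt_mx_ge0 v) cmv) => //.
  - by move=> y; rewrite /S/= in_itv/= tiltE.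
  - move=> y; rewrite /S/= in_itv/= -tiltE => /negP; rewrite -ltNge.
    exact: ltW.
have -> : nuv S = (Phi (t - r))%:E by rewrite -nuvS.
rewrite nuS -[nuv A]/(nu (shift_mx v @^-1` A)).
rewrite -(@fineK _ (nu A)) ?fin_num_measure//.
rewrite -(@fineK _ (nu (shift_mx v @^-1` A))) ?fin_num_measure//.
rewrite -!EFinM -!EFinD !lee_fin.
(* The threshold [t] is the optimal one for [r], not for [b], but the bound at [b] holds for every
   threshold; enlarging the shift from [r] to [b] only lowers the subtracted term. *)
have := Phi_le_g eps t b0.
have : expR eps * Phi (t - b) <= expR eps * Phi (t - r).
  by rewrite ler_wpM2l ?expR_ge0// le_Phi// lerD2l lerN2.
lra.
Qed.

End gaussian_mechanism_matrix.
Arguments std_normal_shift_le {R m n nu} nu_box eps {b v A}.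

(** * Privacy of the mechanism *)

Theorem theorem3 (R : realType) (D : Type) (adj : D -> D -> Prop)
    (adj_sym : forall x x' : D, adj x x' -> adj x' x)
    (m n : nat) (m_ge1 : (1 <= m)%N) (n_ge1 : (1 <= n)%N)
    (f : D -> 'M[R]_(m, n)) (f_fin : (l2_sensitivity adj f < +oo)%E)
    (eps delta : R) (eps_gt0 : 0 < eps) (delta_gt0 : 0 < delta)
    (delta_lt1 : delta < 1)
    (B : R) (B_gt0 : 0 < B) (B_root : g eps B = delta)
    (d : measure_display) (T : measurableType d) (P : probability T R)
    (N : {RV P >-> borel_matrix R m n}) (N_iid : iid_std_normal N) :
  differentially_private adj eps delta
    (fun x : D => additive_noise N (f x) (fine (l2_sensitivity adj f) / B)
       : {RV P >-> borel_matrix R m n}).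
Proof.
have nu_box (A : 'I_m * 'I_n -> set R) : (forall ij, measurable (A ij)) ->
    distribution P N (matrix_box A) =
    (\prod_ij normal_prob (0 : R) 1 (A ij))%E.
  move=> mA; have [indep law] := N_iid.
  transitivity (P (\bigcap_(ij in [set` [set: 'I_m * 'I_n]%SET])
      entry N ij @^-1` A ij)).
    congr (P _); apply/seteqP; split => [w wA ij _|w wA ij]; first exact: wA.
    by apply: wA; rewrite /= inE.
  rewrite indep//; apply: eq_big => [ij|ij _]; first by rewrite inE.
  exact: law.
move=> x x' xx' O mO.
set s := l2_sensitivity adj f; pose w := f x' - f x.
have frobE (A : 'M[R]_(m, n)) : frobenius A = Num.sqrt (mxdot A A).
  by congr Num.sqrt; apply: eq_bigr => i _; apply: eq_bigr => j _; rewrite expr2.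
have dot_ge0 (A : 'M[R]_(m, n)) : 0 <= mxdot A A.
  by apply: sumr_ge0 => i _; apply: sumr_ge0 => j _; rewrite -expr2 sqr_ge0.
pose r : R := Num.sqrt (mxdot w w).
(* The difference [w] is taken from [x] to [x'], so the pair is used in reverse order, by symmetry
   of adjacency. *)
have ws : (r%:E <= s)%E.
  rewrite /r -frobE; apply: ereal_sup_ubound; exists (x', x) => //; exact: adj_sym.
(* The adjacent pair at hand makes the supremum nonnegative, which excludes the value -oo. *)
have s_fin : s \is a fin_num.
  by rewrite ge0_fin_numE//; apply: le_trans ws; rewrite lee_fin sqrtr_ge0.
move: ws; rewrite -(fineK s_fin) lee_fin.
set c := fine s => wc.
(* If [w] is 0, both outputs have the same law and e^eps >= 1 suffices. This also disposes of
   sensitivity 0, where the noise level vanishes and one cannot divide by it. *)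
have [w0|w_neq0] := eqVneq w 0.
  have -> : f x' = f x by apply/eqP; rewrite -subr_eq0 -/w w0.
  set p := P _; have p0 : (0 <= p)%E by exact: measure_ge0.
  apply: (@le_trans _ _ ((expR eps)%:E * p)%E).
    by apply: lee_pemull => //; rewrite lee_fin -expR0 ler_expR ltW.
  by rewrite leeDl// lee_fin ltW.
have w_gt0 : 0 < mxdot w w.
  rewrite lt_neqAle dot_ge0 andbT eq_sym; apply: contra_neq w_neq0 => w0.
  apply/matrixP => i j; rewrite [RHS]mxE; apply/eqP; rewrite -sqrf_eq0.
  have sq_ge0 k l : 0 <= w k l * w k l by rewrite -expr2 sqr_ge0.
  have wi0 : \sum_l w i l * w i l = 0.
    by apply: (psumr_eq0P _ w0) => // k _; exact: sumr_ge0.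
  by rewrite expr2; apply/eqP; apply: (psumr_eq0P _ wi0).
have c_gt0 : 0 < c by apply: lt_le_trans wc; rewrite sqrtr_gt0.
pose sg := c / B.
have sg_gt0 : 0 < sg by rewrite divr_gt0.
pose h (y : borel_matrix R m n) : borel_matrix R m n :=
  f x + sg *: (y : 'M[R]_(m, n)).
have mh : measurable_fun setT h.
  apply: (continuous_measurable_fun_mx R m n (fun y => f x + sg *: y)) => y.
  apply: (@continuousD _ _ _ (fun=> f x) (fun y => sg *: y)).
    exact: cst_continuous.
  exact: scaler_continuous.
have mhO : measurable (h @^-1` O).
  by rewrite -[X in measurable X]setTI; exact: mh.
have sgB : sg * B = c by rewrite /sg divfK// gt_eqF.
(* The shift measured in units of the noise level: |v| = |w| B / c <= B. *)
pose v := sg^-1 *: w.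
have vB : 0 < mxdot v v <= B ^+ 2.
  rewrite mxdotZl mxdotZr mulrA -expr2 mulr_gt0 ?exprn_gt0 ?invr_gt0//=.
  rewrite exprVn ler_pdivrMl ?exprn_gt0// -exprMn sgB.
  by rewrite -(sqr_sqrtr (dot_ge0 w)) ler_sqr ?nnegrE ?sqrtr_ge0 ?(ltW c_gt0).
pose h' (y : borel_matrix R m n) : borel_matrix R m n :=
  f x' + sg *: (y : 'M[R]_(m, n)).
(* The noise event for [x'] is the translate by [v] of the noise event for [x]. *)
have hE : h \o shift_mx v = h'.
  apply/funext => y; rewrite /h /h' /shift_mx/= scalerDr /v scalerA.
  by rewrite divff ?gt_eqF// scale1r (addrC (sg *: _)) addrA subrKC.
have := std_normal_shift_le nu_box eps mhO B_gt0 vB.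
by rewrite -[shift_mx v @^-1` _]/((h \o shift_mx v) @^-1` O) hE B_root.
Qed.
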